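(* Let $1\le p<\infty$. Suppose that for every integer $i\ge 0$: if $1<p<\infty$ then $C_i<\infty$, while if $p=1$ then $B_i<\infty$ for some integer $N_i\in\mathbb{N}$ with $N_i\ge i$; and $\lim_{M\to\infty}b^i_{M,k}=0$ for every integer $k\ge 1$. Then the closed ideals of $(\ell^p(\beta),\diamond)$ are exactly the subspaces $\ell^p_i(\beta)$, $i\in\{0,1,2,\dots\}\cup\{\infty\}$.
   Context: Let $\{\beta(n)\}_{n\ge 0}$ and $\{\delta_n\}_{n\ge 0}$ be sequences of positive numbers with $\beta(0)=1$ and $\delta_0=1$; $\mathbb{N}=\{1,2,\dots\}$. For $1\le p<\infty$, $\ell^p(\beta)$ is the Banach space of complex sequences $f=\{\hat f(n)\}_{n\ge 0}$, written as formal power series $f(z)=\sum_{n\ge 0}\hat f(n)z^n$ (no convergence required), with $\|f\|_\beta^p=\sum_{n\ge 0}|\hat f(n)|^p\beta(n)^p<\infty$. The weighted Cauchy product is $f\diamond g=\sum_{n\ge 0}\sum_{m\ge 0}\frac{\delta_{n+m}}{\delta_n\delta_m}\hat f(n)\hat g(m)z^{n+m}$, i.e. $\widehat{(f\diamond g)}(n)=\sum_{k=0}^n\frac{\delta_n}{\delta_k\delta_{n-k}}\hat f(k)\hat g(n-k)$; with it $\ell^p(\beta)$ is regarded as a unital commutative Banach algebra (norm submultiplicative up to a constant) with unit $1$. For integers $i\ge 0$, $\ell^p_i(\beta)=\{f\in\ell^p(\beta):\hat f(n)=0\text{ for all }n<i\}$, so $\ell^p_0(\beta)=\ell^p(\beta)$;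 and $\ell^p_\infty(\beta)=\{0\}$. For integers $i\ge0$, $M\ge 0$, $k\ge 0$ put (with $q$ the conjugate exponent of $p$ when $1<p<\infty$) $$C_i=\sup_{n\ge i}\sum_{k=i}^{n}\left(\frac{\delta_n\beta(n)}{\delta_k\delta_{n-k+i}\beta(k)\beta(n-k+i)}\right)^{q},\qquad b^i_{M,k}=\sup_{n\ge M+i+1}\frac{\delta_{n+k}\beta(n+k)}{\delta_n\delta_{k+i}\beta(n)\beta(k+i)},$$ and, for $p=1$, $B_i=\sum_{n,m\ge N_i+1}\frac{\delta_{n+m-i}\beta(n+m-i)}{\delta_n\delta_m\beta(n)\beta(m)}$. *)

(* Defs.v *)
From mathcomp Require Import all_boot all_order all_algebra.
From mathcomp Require Import all_classical all_reals all_analysis.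
From mathcomp Require Import complex.

Set Implicit Arguments.
Unset Strict Implicit.
Unset Printing Implicit Defensive.

Import Order.TTheory GRing.Theory Num.Theory.
Import numFieldNormedType.Exports.

Local Open Scope classical_set_scope.
Local Open Scope complex_scope.
Local Open Scope ring_scope.

(* A formal power series is its sequence of coefficients [nat -> R[i]]; the
   complex modulus is the real-valued [ComplexField.Normc.normc]. *)

Definition lp_pnorm (R : realType) (p : R) (beta : nat -> R)
    (f : nat -> R[i]) : \bar R :=
  (\sum_(0 <= n <oo)
    (ComplexField.Normc.normc (f n) `^ p * beta n `^ p)%:E)%E.

Definition lp_norm (R : realType) (p : R) (beta : nat -> R)
    (f : nat -> R[i]) : \bar R :=
  (lp_pnorm p beta f `^ p^-1)%E.

Definition lp_space (R : realType) (p : R) (beta : nat -> R) :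
    set (nat -> R[i]) :=
  [set f | (lp_pnorm p beta f < +oo)%E].

(* [None] stands for the index infinity. *)
Definition lp_sub (R : realType) (p : R) (beta : nat -> R) (i : option nat) :
    set (nat -> R[i]) :=
  if i is Some j then
    [set f | lp_space p beta f /\ forall n, (n < j)%N -> f n = 0]
  else [set cst 0].

Definition wcauchy (R : realType) (delta : nat -> R) (f g : nat -> R[i]) :
    nat -> R[i] :=
  fun n => \sum_(0 <= k < n.+1)
    (delta n / (delta k * delta (n - k)%N))%:C * f k * g (n - k)%N.

(* Since the product is commutative, absorption on one side suffices. *)
Record lp_ideal (R : realType) (p : R) (beta delta : nat -> R)
    (I : set (nat -> R[i])) : Prop := LpIdeal {
  lp_ideal_sub : I `<=` lp_space p beta;
  lp_ideal_0 : I (cst 0);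
  lp_ideal_add : forall f g, I f -> I g -> I (f \+ g);
  lp_ideal_scale : forall (c : R[i]) f, I f -> I (c \*o f);
  lp_ideal_absorb : forall f g,
    lp_space p beta f -> I g -> I (wcauchy delta f g) }.

(* [I] contains its closure in the norm topology of [lp_space p beta]. *)
Definition lp_closed (R : realType) (p : R) (beta : nat -> R)
    (I : set (nat -> R[i])) : Prop :=
  forall f, lp_space p beta f ->
    (forall eps : R, 0 < eps ->
       exists2 g, I g & (lp_norm p beta (f \- g)%R < eps%:E)%E) ->
    I f.

(* The constants below may be infinite, hence are extended real. *)

Definition Cconst (R : realType) (p : R) (beta delta : nat -> R) (i : nat) :
    \bar R :=
  let q := fine (hoelder_conjugate p%:E) in
  ereal_sup [set (\sum_(i <= k < n.+1)
    ((delta n * beta n) /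
     (delta k * delta (n - k + i)%N * beta k * beta (n - k + i)%N)) `^ q)%:E
    | n in [set n | (i <= n)%N]].

Definition bconst (R : realType) (beta delta : nat -> R) (i M k : nat) :
    \bar R :=
  ereal_sup [set ((delta (n + k)%N * beta (n + k)%N) /
     (delta n * delta (k + i)%N * beta n * beta (k + i)%N))%:E
    | n in [set n | (M + i + 1 <= n)%N]].

Definition Bconst (R : realType) (beta delta : nat -> R) (i N : nat) :
    \bar R :=
  (\esum_(x in [set x : nat * nat | (N + 1 <= x.1)%N /\ (N + 1 <= x.2)%N])
    ((delta (x.1 + x.2 - i)%N * beta (x.1 + x.2 - i)%N) /
     (delta x.1 * delta x.2 * beta x.1 * beta x.2))%:E)%E.

(* Main.v *)
Require Import Defs.
From mathcomp Require Import all_boot all_order all_algebra.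
From mathcomp Require Import all_classical all_reals all_analysis.
From mathcomp Require Import complex.
From mathcomp Require Import ring lra zify.

Import Order.TTheory GRing.Theory Num.Theory.
Import numFieldNormedType.Exports.

Local Open Scope classical_set_scope.
Local Open Scope ring_scope.

(** Dividing the coefficients by delta turns the weighted product into the
    ordinary Cauchy product and the weight beta into w = delta beta.

    Let I be a nonzero closed ideal and i the least order of its elements, so
    that I is contained in the i-th subspace; what has to be seen is that I
    contains it. Take f in I of order exactly i, say f = z^i F with F(0)
    nonzero. The space z^-i l^p_i, with weight W(n) = w(n + i), is a Banach
    algebra for the Cauchy product: this is the role of C_i (by Young's
    inequality) when 1 < p, and of B_i together with b^i when p = 1. All these
    hypotheses speak of the single kernel W(n) / (W(k) W(n - k)), and they give
    [conv_bounded]. The hypothesis b^i -> 0 makes this kernel vanish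
    as n - k -> oo for each fixed k > 0, which forces every element with zero
    constant term to be quasinilpotent. Hence F is invertible in this algebra.

    No spectral theory is needed for the last step. Let h be the formal inverse
    of F, so that F(0) h = 1 - rho h with rho(0) = 0. Multiplication by rho,
    restricted to series supported far from 0, has arbitrarily small norm
    ([wsum_conv_tail_small]); so, up to a constant depending only on finitely
    many coefficients, the N-th partial norm of h is at most half of itself, and
    the partial norms are bounded ([wsum_bounded_of_conv_le]).

    The series h itself need not belong to l^p, but its truncations do. Since
    they converge to h in the norm of weight W, the products of f with them lie
    in I and converge to a multiple of z^i ([monomial_in_ideal]). Multiplying
    z^i by the truncations of any series of order at least i and passing to the
    limit shows that I is all of the i-th subspace ([lp_sub_of_monomial]).

    Conversely each subspace is an ideal, since the case i = 0 of the bound makes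
    l^p an algebra, and it is closed, since coefficients are continuous.

    Norms are handled through their p-th powers, as partial sums [wsum] of
    nonnegative reals. Constants are irrelevant throughout, so the inequality
    (a + b)^p <= 2^p (a^p + b^p) replaces Minkowski's. *)

Set Implicit Arguments.
Unset Strict Implicit.

Local Notation normc := ComplexField.Normc.normc.

(** * Powers of sums *)

Lemma le_powR (R : realType) (p x y : R) :
  0 <= p -> 0 <= x -> x <= y -> x `^ p <= y `^ p.
Proof.
move=> p0 x0 xy; apply: ge0_ler_powR => //; rewrite nnegrE //.
exact: le_trans xy.
Qed.

Lemma powRVK (R : realType) (x p : R) : 0 <= x -> 0 < p -> (x `^ p^-1) `^ p = x.
Proof. by move=> x0 p0; rewrite -powRrM mulVf ?gt_eqF// powRr1. Qed.

Lemma powRKV (R : realType) (x p : R) : 0 <= x -> 0 < p -> (x `^ p) `^ p^-1 = x.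
Proof. by move=> x0 p0; rewrite -powRrM mulfV ?gt_eqF// powRr1. Qed.

Lemma powRD_le (R : realType) (p a b : R) : 0 <= p -> 0 <= a -> 0 <= b ->
  (a + b) `^ p <= 2 `^ p * (a `^ p + b `^ p).
Proof.
move=> p0; wlog le_ab : a b / a <= b => [hw a0 b0|a0 b0].
  case: (leP a b) => [le_ab|/ltW le_ba]; first exact: hw.
  by rewrite addrC [X in _ * X]addrC; exact: hw.
apply: (@le_trans _ _ ((2 * b) `^ p)).
  by apply: le_powR; [exact: p0|exact: addr_ge0|lra].
by rewrite powRM// ler_wpM2l ?powR_ge0// lerDr powR_ge0.
Qed.

(** Each term is at most the p-th root of the sum of the p-th powers. Only the
    number [m] of possibly nonzero terms enters the constant, so that it stays
    fixed while [n] grows. *)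
Lemma powR_sum_le (R : realType) (p : R) (m n : nat) (x : nat -> R) :
  0 < p -> (forall k, 0 <= x k) -> (forall k, (m <= k)%N -> x k = 0) ->
  (\sum_(k < n) x k) `^ p <= m%:R `^ p * \sum_(k < n) x k `^ p.
Proof.
move=> p0 x0 xm; set S := \sum_(k < n) x k `^ p.
have S0 : 0 <= S by apply: sumr_ge0 => k _; exact: powR_ge0.
have xS k : (k < n)%N -> x k <= S `^ p^-1.
  move=> kn; rewrite -[leLHS]powRr1// -(@mulfV _ p) ?gt_eqF// powRrM.
  apply: le_powR; [by rewrite invr_ge0 ltW|exact: powR_ge0|].
  rewrite /S (bigD1 (Ordinal kn))//= lerDl.
  by apply: sumr_ge0 => j _; exact: powR_ge0.
have -> : m%:R `^ p * S = (m%:R * S `^ p^-1) `^ p.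
  by rewrite powRM ?powR_ge0// powRVK.
apply: le_powR; [exact: ltW|exact: sumr_ge0|].
have {}xS k : (k < n)%N -> x k <= S `^ p^-1 * (k < m)%N%:R.
  case: (ltnP k m) => [_|/xm-> _]; last by rewrite mulr0.
  by rewrite mulr1; exact: xS.
apply: (le_trans (ler_sum _ (fun k _ => xS _ (ltn_ord k)))).
rewrite -mulr_sumr mulrC ler_wpM2r ?powR_ge0// -natr_sum ler_nat.
suff -> : (\sum_(k < n) (k < m) = minn n m)%N by exact: geq_minr.
elim: {x0 xm S S0 xS x} n => [|n IH]; first by rewrite big_ord0 min0n.
by rewrite big_ord_recr/= IH; lia.
Qed.

(** * The Cauchy product and truncations *)

Definition conv (K : pzRingType) (a b : nat -> K) (n : nat) : K :=
  \sum_(k < n.+1) a k * b (n - k)%N.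

Lemma sum_conv_le (R : realType) (u v : nat -> R) N :
  (forall n, 0 <= u n) -> (forall n, 0 <= v n) ->
  \sum_(n < N) conv u v n <= (\sum_(n < N) u n) * \sum_(n < N) v n.
Proof.
move=> u0 v0.
(* summing over antidiagonals, regrouped by the first index *)
have -> : \sum_(n < N) conv u v n =
          \sum_(k < N) u k * \sum_(j < N - k) v j.
  elim: N => [|N IH]; first by rewrite !big_ord0.
  rewrite big_ord_recr/= IH [RHS]big_ord_recr/= /conv [X in _ + X]big_ord_recr/=.
  rewrite addrA -big_split/= subSnn subnn big_ord1; congr (_ + _).
  apply: eq_bigr => k _; rewrite -mulrDr; congr (_ * _).
  by rewrite (subSn (ltnW (ltn_ord k))) big_ord_recr.
rewrite mulr_suml; apply: ler_sum => k _; apply: ler_wpM2l => //.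
rewrite (big_ord_widen _ _ (leq_subr k N)).
rewrite [leRHS](bigID (fun j : 'I_N => (j < N - k)%N))/=.
by rewrite lerDl; exact: sumr_ge0.
Qed.

Definition tail (V : nmodType) (T : nat) (a : nat -> V) n :=
  if (n < T)%N then 0 else a n.
Definition trunc (V : nmodType) (T : nat) (a : nat -> V) n :=
  if (n < T)%N then a n else 0.

(** * Weighted partial norms *)

Section WeightedSums.
Variables (R : realType) (p : R) (W : nat -> R).
Hypotheses (p_ge1 : 1 <= p) (W_gt0 : forall n, 0 < W n).

(** The p-th power of the N-th partial norm of weight [W]. *)
Definition wsum (N : nat) (a : nat -> R) : R := \sum_(n < N) (a n * W n) `^ p.

Let p_gt0 : 0 < p. Proof. exact: lt_le_trans p_ge1. Qed.
Let p_ge0 : 0 <= p. Proof. exact: ltW. Qed.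
Let W_ge0 n : 0 <= W n. Proof. exact: ltW. Qed.

Lemma wsum_ge0 N a : 0 <= wsum N a.
Proof. by apply: sumr_ge0 => n _; exact: powR_ge0. Qed.

Lemma le_wsum N a b : (forall n, 0 <= a n) -> (forall n, a n <= b n) ->
  wsum N a <= wsum N b.
Proof.
move=> a0 ab; apply: ler_sum => n _; apply: le_powR => //.
  by rewrite mulr_ge0.
by rewrite ler_wpM2r.
Qed.

Lemma wsumD N a b : (forall n, 0 <= a n) -> (forall n, 0 <= b n) ->
  wsum N (a \+ b) <= 2 `^ p * (wsum N a + wsum N b).
Proof.
move=> a0 b0; rewrite /wsum -big_split mulr_sumr; apply: ler_sum => n _.
by rewrite /= mulrDl powRD_le// mulr_ge0.
Qed.

Lemma wsumZ N c a : 0 <= c -> (forall n, 0 <= a n) ->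
  wsum N (fun n => c * a n) = c `^ p * wsum N a.
Proof.
move=> c0 a0; rewrite /wsum mulr_sumr; apply: eq_bigr => n _.
by rewrite -mulrA powRM// mulr_ge0.
Qed.

Lemma wsum_mono N N' a : (N <= N')%N -> wsum N a <= wsum N' a.
Proof.
move=> NN'; rewrite /wsum (big_ord_widen _ (fun n => (a n * W n) `^ p) NN').
rewrite [leRHS](bigID (fun j : 'I_N' => (j < N)%N))/= lerDl.
by apply: sumr_ge0 => *; exact: powR_ge0.
Qed.

Lemma trunc_ge0 T (a : nat -> R) n : (forall n, 0 <= a n) -> 0 <= trunc T a n.
Proof. by move=> a0; rewrite /trunc; case: ifP. Qed.

Lemma tail_ge0 T (a : nat -> R) n : (forall n, 0 <= a n) -> 0 <= tail T a n.
Proof. by move=> a0; rewrite /tail; case: ifP. Qed.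

Lemma wsum_trunc N T a : wsum N (trunc T a) <= wsum T a.
Proof.
apply: (@le_trans _ _ (wsum (N + T) (trunc T a))).
  exact/wsum_mono/leq_addr.
rewrite /wsum (big_ord_widen _ (fun n => (a n * W n) `^ p) (leq_addl N T)).
rewrite [leRHS]big_mkcond; apply: ler_sum => n _; rewrite /trunc; case: ifP => // _.
by rewrite mul0r powR0 ?gt_eqF.
Qed.

Lemma wsum_tail_split T N a : (T <= N)%N ->
  wsum N a = wsum T a + wsum N (tail T a).
Proof.
move=> TN; rewrite /wsum (big_ord_widen _ (fun n => (a n * W n) `^ p) TN).
rewrite [X in X + _]big_mkcond -big_split; apply: eq_bigr => n _ /=.
by rewrite /tail; case: ifP => _; rewrite ?mul0r ?powR0 ?gt_eqF ?addr0 ?add0r.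
Qed.

(** Bounded partial sums come within [e] of their supremum at some rank [T], so
    at most [e] is left after it. *)
Lemma wsum_tail_small a B : (forall N, wsum N a <= B) ->
  forall e, 0 < e -> exists T, forall N, wsum N (tail T a) <= e.
Proof.
move=> aB e e0; pose E := range (wsum ^~ a).
have hE : has_sup E.
  by split; [exists (wsum 0 a), 0%N|exists B => _ [N _ <-]].
have [_ [T _ <-] hT] := sup_adherent e0 hE.
exists T => N; apply: (@le_trans _ _ (wsum (T + N) (tail T a))).
  exact/wsum_mono/leq_addl.
have : wsum (T + N) a <= sup E by apply: sup_upper_bound => //; exists (T + N)%N.
by rewrite (wsum_tail_split _ (leq_addr N T)); lra.
Qed.

(** The ratio that a submultiplicative weight would keep at most 1. *)
Definition kernel n k := W n / (W k * W (n - k)%N).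

(** The common consequence of the hypotheses for 1 < p and for p = 1: it is what
    makes the Cauchy product bounded in the weighted norm ([wsum_conv]). *)
Definition conv_bounded (K : R) := forall n (x : nat -> R), (forall k, 0 <= x k) ->
  (\sum_(k < n.+1) x k * kernel n k) `^ p <= K * \sum_(k < n.+1) x k `^ p.

Lemma convW (a b : nat -> R) n :
  conv a b n * W n =
  \sum_(k < n.+1) ((a k * W k) * (b (n - k)%N * W (n - k)%N)) * kernel n k.
Proof.
rewrite /conv mulr_suml; apply: eq_bigr => k _; rewrite /kernel.
by field; rewrite !gt_eqF.
Qed.

(** The kernel estimate is asked only of the given [a] and [b]: for truncated
    sequences it holds with a much smaller constant than in general. *)
Lemma wsum_conv_pointwise (K : R) N (a b : nat -> R) :
  (forall n, 0 <= a n) -> (forall n, 0 <= b n) ->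
  (forall n, (\sum_(k < n.+1) ((a k * W k) * (b (n - k)%N * W (n - k)%N)) *
     kernel n k) `^ p
   <= K * \sum_(k < n.+1) ((a k * W k) * (b (n - k)%N * W (n - k)%N)) `^ p) ->
  0 <= K -> wsum N (conv a b) <= K * (wsum N a * wsum N b).
Proof.
move=> a0 b0 hK K0.
apply: (@le_trans _ _ (K * \sum_(n < N) conv (fun n => (a n * W n) `^ p)
          (fun n => (b n * W n) `^ p) n)); last first.
  by rewrite ler_wpM2l// sum_conv_le// => n; exact: powR_ge0.
rewrite mulr_sumr; apply: ler_sum => n _; rewrite convW.
apply: (le_trans (hK n)); rewrite ler_wpM2l//; apply: ler_sum => k _.
by rewrite powRM// mulr_ge0.
Qed.

Lemma wsum_conv (K : R) N (a b : nat -> R) : 0 <= K -> conv_bounded K ->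
  (forall n, 0 <= a n) -> (forall n, 0 <= b n) ->
  wsum N (conv a b) <= K * (wsum N a * wsum N b).
Proof.
move=> K0 hK a0 b0; apply: wsum_conv_pointwise => // n.
apply: (hK n (fun k => (a k * W k) * (b (n - k)%N * W (n - k)%N))) => k.
by rewrite !mulr_ge0.
Qed.

(** * Multiplication far from the origin *)

Section Quasinilpotent.
Variable K : R.
Hypotheses (K_ge0 : 0 <= K) (convK : conv_bounded K).
Hypothesis kernel_small : forall k, (1 <= k)%N -> forall e, 0 < e ->
  exists M, forall m, (M <= m)%N -> kernel (m + k) k <= e.

Lemma kernel_ge0 n k : 0 <= kernel n k.
Proof. by rewrite /kernel divr_ge0// mulr_ge0. Qed.

Lemma kernel_small_unif L e : 0 < e -> exists M, forall k m,
  (1 <= k < L)%N -> (M <= m)%N -> kernel (m + k) k <= e.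
Proof.
move=> e0; elim: L => [|L [M IH]]; first by exists 0%N => k m; rewrite ltn0 andbF.
case: L IH => [_|L IH]; first by exists 0%N => k m; lia.
have [M' hM'] := kernel_small (ltn0Sn L) e0.
exists (maxn M M') => k m /andP[k1]; rewrite ltnS leq_eqVlt => /orP[/eqP->|kL].
  by rewrite geq_max => /andP[_]; exact: hM'.
by rewrite geq_max => /andP[+ _]; apply: IH; rewrite k1.
Qed.

(** In the products at stake 1 <= k < L and n - k >= M, so every occurring kernel
    is at most [e]; there are at most [L] terms in each coefficient. *)
Lemma wsum_conv_trunc_tail L M (e : R) N (a b : nat -> R) : 0 <= e ->
  (forall n, 0 <= a n) -> (forall n, 0 <= b n) -> a 0%N = 0 ->
  (forall k m, (1 <= k < L)%N -> (M <= m)%N -> kernel (m + k) k <= e) ->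
  wsum N (conv (trunc L a) (tail M b)) <= (e * L%:R) `^ p * (wsum N a * wsum N b).
Proof.
move=> e0 a0 b0 a00 he; set s := trunc L a; set t := tail M b.
have s0 n : 0 <= s n by exact: trunc_ge0.
have t0 n : 0 <= t n by exact: tail_ge0.
have sa : wsum N s <= wsum N a.
  by apply: le_wsum => // n; rewrite /s /trunc; case: ifP.
have tb : wsum N t <= wsum N b.
  by apply: le_wsum => // n; rewrite /t /tail; case: ifP.
apply: (@le_trans _ _ ((e * L%:R) `^ p * (wsum N s * wsum N t))); last first.
  by rewrite ler_wpM2l ?powR_ge0// ler_pM ?wsum_ge0.
apply: wsum_conv_pointwise => //; last exact: powR_ge0.
move=> n; pose x k := (s k * W k) * (t (n - k)%N * W (n - k)%N).
have x0 k : 0 <= x k by rewrite /x !mulr_ge0.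
rewrite powRM// -mulrA.
apply: (@le_trans _ _ (e `^ p * (\sum_(k < n.+1) x k) `^ p)); last first.
  rewrite ler_wpM2l ?powR_ge0//.
  apply: (@powR_sum_le _ _ L _ x) => // k Lk.
  by rewrite /x /s /trunc ltnNge Lk/= !mul0r.
rewrite -powRM// ?sumr_ge0//; apply: le_powR => //.
  by rewrite sumr_ge0// => k _; rewrite mulr_ge0 ?kernel_ge0 //; exact: x0.
rewrite mulr_sumr; apply: ler_sum => k _; rewrite -/(x k).
have [->|xk] := eqVneq (x k) 0; first by rewrite mul0r mulr0.
rewrite mulrC ler_wpM2r//.
have kn : (k <= n)%N by rewrite -ltnS.
have k0 : (0 < k)%N.
  rewrite lt0n; apply: contra_neq xk => k0.
  by rewrite /x /s /trunc k0 a00; case: ifP; rewrite !mul0r.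
have kL : (k < L)%N.
  rewrite ltnNge; apply: contraNN xk => Lk.
  by rewrite /x /s /trunc ltnNge Lk !mul0r.
have Mm : (M <= n - k)%N.
  by rewrite leqNgt; apply: contraNN xk => Lk; rewrite /x /t /tail Lk !mul0r mulr0.
by have := he k (n - k)%N _ Mm; rewrite subnK// k0 kL; exact.
Qed.

(** Split [a] at [L]: the far part has small norm, so multiplication by it is
    small by [conv_bounded]; the near part involves only finitely many shifts,
    each of which is small beyond [M]. This is the quantitative form of the
    quasinilpotence of series without constant term. *)
Lemma wsum_conv_tail_small (a : nat -> R) B :
  (forall n, 0 <= a n) -> a 0%N = 0 -> (forall N, wsum N a <= B) ->
  forall e, 0 < e -> exists M, forall (b : nat -> R), (forall n, 0 <= b n) ->
  forall N, wsum N (conv a (tail M b)) <= e * wsum N b.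
Proof.
move=> a0 a00 aB e e0.
have B0 : 0 <= B by apply: le_trans (aB 0%N); exact: wsum_ge0.
pose c : R := 2 `^ p; have c0 : 0 < c by rewrite powR_gt0.
pose e1 := e / (2 * c); have e10 : 0 < e1 by rewrite divr_gt0// mulr_gt0.
have K1 : 0 < K + 1 by rewrite ltr_wpDl.
have B1 : 0 < B + 1 by rewrite ltr_wpDl.
have [L hL] := wsum_tail_small aB (divr_gt0 e10 K1).
(* [eta] is chosen so that the constant (eta L)^p times the bound [B] is at most
   [e1]; the successor of [L] keeps the denominator nonzero *)
pose r := e1 / (B + 1); have r0 : 0 < r by rewrite divr_gt0.
pose eta := r `^ p^-1 / L.+1%:R.
have eta0 : 0 < eta by rewrite divr_gt0// powR_gt0.
have etaL : (eta * L%:R) `^ p <= r.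
  rewrite -[leRHS](powRVK (ltW r0) p_gt0).
  apply: le_powR => //; [by rewrite mulr_ge0// ltW|].
  rewrite /eta mulrAC -mulrA ler_piMr ?powR_ge0//.
  by rewrite ler_pdivrMr// mul1r ler_nat.
have [M hM] := kernel_small_unif L eta0.
exists M => b b0 N; set t := tail M b.
have t0 n : 0 <= t n by exact: tail_ge0.
have tb : wsum N t <= wsum N b.
  by apply: le_wsum => // n; rewrite /t /tail; case: ifP.
have -> : conv a t = conv (trunc L a) t \+ conv (tail L a) t.
  apply/funext => n; rewrite /conv /= -big_split; apply: eq_bigr => k _ /=.
  by rewrite -mulrDl /trunc /tail; case: ifP; rewrite ?addr0 ?add0r.
have u0 n : 0 <= trunc L a n by exact: trunc_ge0.
have v0 n : 0 <= tail L a n by exact: tail_ge0.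
apply: (le_trans (wsumD _ _ _)) => [n|n|].
- by apply: sumr_ge0 => k _; rewrite mulr_ge0.
- by apply: sumr_ge0 => k _; rewrite mulr_ge0.
have h1 : wsum N (conv (trunc L a) t) <= e1 * wsum N b.
  apply: (le_trans (wsum_conv_trunc_tail N (ltW eta0) a0 b0 a00 hM)).
  rewrite mulrA ler_wpM2r ?wsum_ge0//.
  apply: (@le_trans _ _ (r * B)); first by rewrite ler_pM ?powR_ge0 ?wsum_ge0.
  by rewrite /r mulrAC ler_pdivrMr// ler_pM2l// lerDl.
have h2 : wsum N (conv (tail L a) t) <= e1 * wsum N b.
  apply: (le_trans (wsum_conv N K_ge0 convK v0 t0)).
  rewrite mulrA ler_pM ?wsum_ge0 ?mulr_ge0 ?wsum_ge0//.
  apply: (@le_trans _ _ (K * (e1 / (K + 1)))); first by rewrite ler_wpM2l.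
  by rewrite mulrCA ler_piMr ?(ltW e10)// ler_pdivrMr// mul1r lerDl.
apply: (@le_trans _ _ (c * (e1 * wsum N b + e1 * wsum N b))).
  by rewrite ler_wpM2l ?(ltW c0)// lerD.
have -> : e = c * (e1 + e1) by rewrite /e1; field; rewrite gt_eqF.
by rewrite -mulrDl mulrA.
Qed.

(** The partial norm of [b] is bounded by a constant plus half of itself: cut [b]
    at [M] so that [a] acts on its tail with norm small compared with [f0], while
    the product with the head is bounded once and for all. *)
Lemma wsum_bounded_of_conv_le (f0 : R) (a b : nat -> R) B :
  0 < f0 -> (forall n, 0 <= a n) -> (forall n, 0 <= b n) -> a 0%N = 0 ->
  (forall N, wsum N a <= B) ->
  (forall n, f0 * b n <= (n == 0%N)%:R + conv a b n) ->
  exists B', forall N, wsum N b <= B'.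
Proof.
move=> f00 a0 b0 a00 aB hb.
pose c : R := 2 `^ p; have c0 : 0 < c by rewrite powR_gt0.
pose g := f0 `^ p; have g0 : 0 < g by rewrite powR_gt0.
have e0 : 0 < g / (2 * c ^+ 2) by rewrite divr_gt0// mulr_gt0// exprn_gt0.
have [M hM] := wsum_conv_tail_small a0 a00 aB e0.
pose one n : R := (n == 0%N)%:R.
pose E := wsum 1 one; pose D := K * (B * wsum M b).
have one0 n : 0 <= one n by [].
have u0 n : 0 <= trunc M b n by exact: trunc_ge0.
have v0 n : 0 <= tail M b n by exact: tail_ge0.
have c1 n : 0 <= conv a (trunc M b) n by apply: sumr_ge0 => k _; rewrite mulr_ge0.
have c2 n : 0 <= conv a (tail M b) n by apply: sumr_ge0 => k _; rewrite mulr_ge0.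
exists (2 * (c * (E + c * D)) / g) => N; rewrite ler_pdivlMr//.
have hE : wsum N one <= E.
  have -> : one = trunc 1 one by apply/funext; case.
  exact: wsum_trunc.
have hD : wsum N (conv a (trunc M b)) <= D.
  apply: (le_trans (wsum_conv N K_ge0 convK a0 u0)).
  by rewrite ler_wpM2l// ler_pM ?wsum_ge0 ?wsum_trunc.
have h1 : g * wsum N b <= wsum N (one \+ (conv a (trunc M b) \+ conv a (tail M b))).
  rewrite -wsumZ ?(ltW f00)//; apply: le_wsum => n.
    by rewrite mulr_ge0// ltW.
  apply: (le_trans (hb n)); rewrite /= lerD2l /conv -big_split.
  apply: ler_sum => k _ /=.
  by rewrite -mulrDr /trunc /tail; case: ifP; rewrite ?addr0 ?add0r.
have h2 := wsumD N one0 (fun n => addr_ge0 (c1 n) (c2 n)).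
have h3 := wsumD N c1 c2.
have h4 := hM _ b0 N.
have h5 : g * wsum N b <= c * (E + c * (D + g / (2 * c ^+ 2) * wsum N b)).
  apply: (le_trans h1); apply: (le_trans h2); rewrite ler_wpM2l ?(ltW c0)// lerD//.
  by apply: (le_trans h3); rewrite ler_wpM2l ?(ltW c0)// lerD.
have h6 : c * (E + c * (D + g / (2 * c ^+ 2) * wsum N b)) =
   c * (E + c * D) + g * wsum N b / 2 by field; rewrite gt_eqF.
by move: h5; rewrite h6 mulrC; lra.
Qed.

End Quasinilpotent.
End WeightedSums.

(** * Kernel bounds from the constants C, B and b *)

(** Hoelder's inequality up to a constant: after normalising [x] to have unit
    p-norm, apply Young's inequality to each term. *)
Lemma conv_bounded_of_hoelder (R : realType) (p q : R) (W : nat -> R) (C : R) :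
  (forall n, 0 < W n) -> 0 < p -> 0 < q -> p^-1 + q^-1 = 1 ->
  (forall n, \sum_(k < n.+1) kernel W n k `^ q <= C) ->
  conv_bounded p W ((p^-1 + C / q) `^ p).
Proof.
move=> W0 p0 q0 pq hC n x x0; set S := \sum_(k < n.+1) x k `^ p.
have K0 k : 0 <= kernel W n k by rewrite /kernel divr_ge0 ?mulr_ge0 ?ltW.
have S0 : 0 <= S by apply: sumr_ge0 => k _; exact: powR_ge0.
have C0 : 0 <= C.
  by apply: le_trans (hC n); apply: sumr_ge0 => k _; exact: powR_ge0.
have D0 : 0 <= p^-1 + C / q by rewrite addr_ge0 ?divr_ge0// ?invr_ge0 ltW.
rewrite -(powRVK S0 p0) -powRM ?powR_ge0//.
apply: le_powR; [exact: ltW| |].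
  by apply: sumr_ge0 => k _; rewrite mulr_ge0.
have [S_eq0|S_neq0] := eqVneq S 0.
  have xz (k : 'I_n.+1) : x k = 0.
    apply/(@powR_eq0_eq0 _ _ p)/le_anti/andP; split; last exact: powR_ge0.
    rewrite -S_eq0 /S (bigD1 k)//= lerDl.
    by apply: sumr_ge0 => j _; exact: powR_ge0.
  rewrite big1 => [|k _]; first by rewrite mulr_ge0 ?powR_ge0.
  by rewrite xz mul0r.
have Spos : 0 < S by rewrite lt_neqAle eq_sym S_neq0.
pose X := S `^ p^-1; have X0 : 0 < X by rewrite powR_gt0.
have XV : X^-1 `^ p = S^-1.
  by rewrite -(powR_inv1 (ltW X0)) powRAC (powRVK S0 p0) powR_inv1.
rewrite -/X -ler_pdivrMr// mulr_suml.
apply: (@le_trans _ _ (\sum_(k < n.+1) (x k `^ p / S / p + kernel W n k `^ q / q))).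
  apply: ler_sum => k _; rewrite mulrAC.
  apply: (le_trans (conjugate_powR _ _ p0 q0 pq)) => //.
    by rewrite divr_ge0// ltW.
  by rewrite powRM ?invr_ge0 ?(ltW X0)// XV.
rewrite big_split -!mulr_suml -/S divff// mul1r lerD2l.
by rewrite ler_wpM2r ?invr_ge0 ?(ltW q0).
Qed.

Lemma conv_bounded_of_kernel_le (R : realType) (W : nat -> R) (C : R) :
  (forall n, 0 < W n) ->
  (forall n k, (k <= n)%N -> kernel W n k <= C) -> conv_bounded 1 W C.
Proof.
move=> W0 hC n x x0.
rewrite powRr1; last first.
  apply: sumr_ge0 => k _.
  by rewrite mulr_ge0// /kernel divr_ge0 ?mulr_ge0 ?ltW.
rewrite mulr_sumr; apply: ler_sum => k _; rewrite powRr1// mulrC ler_wpM2r//.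
exact/hC/(leq_ord k).
Qed.

Lemma ereal_sup_lty_bound (R : realType) (S : set (\bar R)) :
  (ereal_sup S < +oo)%E -> exists C : R, forall r, S r%:E -> r <= C.
Proof.
have := @ereal_sup_ubound R S; case: (ereal_sup S) => [C| |] // ub _.
  by exists C => r /ub; rewrite lee_fin.
by exists 0 => r /ub.
Qed.

Lemma hoelder_conjugate_fin (R : realType) (p : R) : 1 < p ->
  fine (hoelder_conjugate p%:E) = p / (p - 1).
Proof.
move=> p1; have p0 : p != 0 by rewrite gt_eqF// (lt_trans ltr01).
rewrite /hoelder_conjugate/= eqe (negbTE p0).
by rewrite inver subr_eq0 gt_eqF.
Qed.

Section Weights.
Variables (R : realType) (beta delta : nat -> R).
Hypotheses (beta_gt0 : forall n, 0 < beta n) (delta_gt0 : forall n, 0 < delta n).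

(** The weight of the series F in the factorisation f = z^i F, once the
    coefficients have been divided by [delta]. *)
Definition shiftw i n := delta (n + i)%N * beta (n + i)%N.

Lemma shiftw_gt0 i n : 0 < shiftw i n.
Proof. by rewrite mulr_gt0. Qed.

Lemma kernel_shiftw_small i :
  (forall k, (1 <= k)%N -> bconst beta delta i M k @[M --> \oo] --> (0 : \bar R)) ->
  forall k, (1 <= k)%N -> forall e, 0 < e ->
  exists M, forall m, (M <= m)%N -> kernel (shiftw i) (m + k) k <= e.
Proof.
move=> hb k k1 e e0.
have := hb k k1 [set y | (y < e%:E)%E].
case; first exact: (@nbhs_open_ereal_lt _ 0 (fun=> e)).
move=> M _ hM; exists M.+1 => m Mm; rewrite -lee_fin.
apply: (le_trans _ (ltW (hM M (leqnn M)))).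
apply: ereal_sup_ubound => /=; exists (m + i)%N; first lia.
congr EFin; rewrite /kernel /shiftw addnK (addnAC m k i).
by congr (_ / _); ring.
Qed.

Lemma conv_bounded_shiftw_Cconst (p : R) i :
  1 < p -> (Cconst p beta delta i < +oo)%E ->
  exists2 K, 0 <= K & conv_bounded p (shiftw i) K.
Proof.
move=> p1 /ereal_sup_lty_bound[C]; rewrite hoelder_conjugate_fin//.
set q := p / (p - 1) => hC.
have p0 : 0 < p by exact: lt_trans p1.
have q0 : 0 < q by rewrite divr_gt0// subr_gt0.
exists ((p^-1 + C / q) `^ p); first exact: powR_ge0.
apply: conv_bounded_of_hoelder => // [n||n]; first exact: shiftw_gt0.
  by rewrite /q; field; rewrite !gt_eqF// subr_gt0.
apply: hC => /=; exists (n + i)%N; first exact: leq_addl.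
congr EFin; rewrite -addSn -[X in index_iota X _]add0n big_addn addnK big_mkord.
apply: eq_bigr => k _; congr (_ `^ _); rewrite /kernel /shiftw.
by rewrite subnDr; congr (_ / _); ring.
Qed.

(** For k > 0 the kernel is eventually at most 1 by the limit hypothesis, and
    finitely many values remain; for k = 0 it is constant. *)
Lemma kernel_shiftw_bounded i k :
  (forall k, (1 <= k)%N -> bconst beta delta i M k @[M --> \oo] --> (0 : \bar R)) ->
  exists C, forall m, kernel (shiftw i) (m + k) k <= C.
Proof.
move=> hb; case: k => [|k].
  exists (shiftw i 0)^-1 => m.
  by rewrite /kernel addn0 subn0 invfM mulrCA mulfV ?mulr1// gt_eqF ?shiftw_gt0.
have [M hM] := kernel_shiftw_small hb (ltn0Sn k) ltr01.
exists (1 + \sum_(m < M) kernel (shiftw i) (m + k.+1) k.+1) => m.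
have K0 n j : 0 <= kernel (shiftw i) n j.
  by apply: kernel_ge0 => ?; exact: shiftw_gt0.
case: (leqP M m) => [/hM/le_trans->//|mM]; first by rewrite lerDl sumr_ge0.
by rewrite (bigD1 (Ordinal mM))//= addrCA lerDl addr_ge0// sumr_ge0.
Qed.

Lemma kernelC (W : nat -> R) n k : (k <= n)%N -> kernel W n (n - k) = kernel W n k.
Proof. by move=> kn; rewrite /kernel subKn// (mulrC (W k)). Qed.

(** A convergent sum of nonnegative terms bounds each of them, which takes care
    of the indices with both k and n - k beyond [N]. If one of the two is at most
    [N], [kernel_shiftw_bounded] applies, after exchanging k and n - k if
    necessary. *)
Lemma conv_bounded_shiftw_Bconst i N : (i <= N)%N ->
  (Bconst beta delta i N < +oo)%E ->
  (forall k, (1 <= k)%N -> bconst beta delta i M k @[M --> \oo] --> (0 : \bar R)) ->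
  exists2 K, 0 <= K & conv_bounded 1 (shiftw i) K.
Proof.
move=> iN hB hb.
have [C hC] : exists C, forall k m, (k <= N)%N -> kernel (shiftw i) (m + k) k <= C.
  have [c hc] := choice (fun k => kernel_shiftw_bounded k hb).
  have c0 k : 0 <= c k.
    by apply: le_trans (hc k 0%N); apply: kernel_ge0 => n; exact: shiftw_gt0.
  exists (\sum_(k < N.+1) c k) => k m kN; apply: (le_trans (hc k m)).
  by rewrite (bigD1 (Ordinal (kN : (k < N.+1)%N)))//= lerDl sumr_ge0.
have [D hD] : exists D, forall k m, (N < k)%N -> (N < m)%N ->
    kernel (shiftw i) (m + k) k <= D.
  move: hB; rewrite /Bconst; set E := esum _ _ => hE.
  have E0 : (0 <= E)%E.
    by apply: esum_ge0 => x _; rewrite lee_fin divr_ge0 ?mulr_ge0 ?ltW.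
  exists (fine E) => k m Nk Nm; rewrite -lee_fin fineK; last first.
    by rewrite ge0_fin_numE.
  apply: esum_ge; exists [set (m + i, k + i)%N].
    split; first exact: finite_set1.
    by move=> _ -> /=; lia.
  rewrite fsbig_set1/= lee_fin /kernel /shiftw addnK.
  have -> : (m + i + (k + i) - i = m + k + i)%N by lia.
  by rewrite le_eqVlt; apply/orP; left; apply/eqP; congr (_ / _); ring.
have CD n k : (k <= n)%N -> kernel (shiftw i) n k <= Num.max (Num.max C D) 0.
  move=> kn; rewrite !le_max.
  case: (leqP k N) => kN; first by have := hC _ (n - k)%N kN; rewrite subnK// => ->.
  case: (leqP (n - k) N) => nkN.
    by have := hC _ k nkN; rewrite subnKC// kernelC// => ->.
  by have := hD _ _ kN nkN; rewrite subnK// => ->; rewrite orbT.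
exists (Num.max (Num.max C D) 0); first by rewrite le_max lexx orbT.
by apply: conv_bounded_of_kernel_le => // n; exact: shiftw_gt0.
Qed.

End Weights.

(** * The modulus and the formal inverse *)

Lemma normc_ge0 (R : realType) (x : complex R) : 0 <= normc x.
Proof. by case: x => a b; exact: sqrtr_ge0. Qed.

Lemma normcR (R : realType) (x : R) : normc (real_complex R x) = `|x|.
Proof. by rewrite /= expr0n addr0 sqrtr_sqr. Qed.

Lemma normc_sum (R : realType) n (F : nat -> complex R) :
  normc (\sum_(k < n) F k) <= \sum_(k < n) normc (F k).
Proof.
elim: n => [|n IH]; first by rewrite !big_ord0 ComplexField.Normc.normc0.
by rewrite !big_ord_recr/=; apply: (le_trans (le_normcD _ _)); rewrite lerD2r.
Qed.

Lemma normc_conv (R : realType) (a b : nat -> complex R) n :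
  normc (conv a b n) <= conv (fun k => normc (a k)) (fun k => normc (b k)) n.
Proof.
apply: (le_trans (normc_sum _ (fun k => a k * b (n - k)%N))).
by apply: ler_sum => k _; rewrite ComplexField.Normc.normcM.
Qed.

Lemma convC (K : comPzRingType) (a b : nat -> K) n : conv a b n = conv b a n.
Proof.
rewrite /conv (reindex_inj rev_ord_inj); apply: eq_bigr => k _.
by rewrite mulrC /= subSS subKn// -ltnS.
Qed.

Lemma conv_tail_trunc (K : pzRingType) T (a b : nat -> K) n :
  conv a b n - conv (trunc T a) b n = conv (tail T a) b n.
Proof.
rewrite /conv -sumrB; apply: eq_bigr => k _.
by rewrite -mulrBl /trunc /tail; case: ifP; rewrite ?subr0 ?subrr.
Qed.

Section FormalInverse.
Variables (K : fieldType) (F : nat -> K).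
Hypothesis F0 : F 0%N != 0.

(** The first [n] coefficients of the inverse, each solving the linear equation
    that the next coefficient of the product imposes on it. *)
Fixpoint inverse_coefs n : seq K :=
  if n is m.+1 then
    rcons (inverse_coefs m)
      (((m == 0%N)%:R - \sum_(k < m) (inverse_coefs m)`_k * F (m - k)%N) / F 0%N)
  else [::].

Lemma size_inverse_coefs n : size (inverse_coefs n) = n.
Proof. by elim: n => //= n IH; rewrite size_rcons IH. Qed.

Lemma nth_inverse_coefs n k : (k < n)%N ->
  (inverse_coefs n)`_k = (inverse_coefs k.+1)`_k.
Proof.
elim: n => // n IH; rewrite ltnS leq_eqVlt => /orP[/eqP->//|kn].
by rewrite [in LHS]/= nth_rcons size_inverse_coefs kn IH.
Qed.

Lemma formal_inverse : exists h : nat -> K, forall n, conv h F n = (n == 0%N)%:R.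
Proof.
exists (fun k => (inverse_coefs k.+1)`_k) => n.
rewrite /conv big_ord_recr [inverse_coefs n.+1]/= nth_rcons size_inverse_coefs.
rewrite ltnn eqxx subnn divfK// [X in _ - X](_ : _ =
  \sum_(k < n) (inverse_coefs k.+1)`_k * F (n - k)%N); first exact: subrKC.
by apply: eq_bigr => k _; rewrite nth_inverse_coefs.
Qed.

End FormalInverse.

(** * The sequence space through partial sums *)

Section LpSpace.
Variables (R : realType) (p : R) (beta : nat -> R).
Hypotheses (beta_gt0 : forall n, 0 < beta n) (p_ge1 : 1 <= p).
Let p_gt0 : 0 < p. Proof. exact: lt_le_trans p_ge1. Qed.
Let beta_ge0 n : 0 <= beta n. Proof. exact: ltW. Qed.

Definition psum N (f : nat -> complex R) := wsum p beta N (fun n => normc (f n)).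

Lemma lp_pnorm_le (f : nat -> complex R) (B : R) :
  (lp_pnorm p beta f <= B%:E)%E <-> forall N, psum N f <= B.
Proof.
have t0 n : (0 <= (normc (f n) `^ p * beta n `^ p)%:E)%E.
  by rewrite lee_fin mulr_ge0 ?powR_ge0.
have psumE N :
  (\sum_(0 <= n < N) (normc (f n) `^ p * beta n `^ p)%:E)%E = (psum N f)%:E.
  rewrite sumEFin big_mkord /psum /wsum; congr EFin; apply: eq_bigr => n _.
  by rewrite powRM ?normc_ge0.
split => [fB N|fB].
  rewrite -lee_fin -psumE; apply: le_trans fB.
  exact: nneseries_lim_ge.
apply: lime_le; first exact: is_cvg_nneseries.
by apply: nearW => N; rewrite psumE lee_fin.
Qed.

Lemma lp_pnorm_ge0 (f : nat -> complex R) : (0 <= lp_pnorm p beta f)%E.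
Proof.
apply: nneseries_ge0 => n _ _.
by rewrite lee_fin mulr_ge0 ?powR_ge0.
Qed.

Lemma lp_spaceP (f : nat -> complex R) :
  lp_space p beta f <-> exists B, forall N, psum N f <= B.
Proof.
rewrite /lp_space /=; split => [|[B /lp_pnorm_le fB]]; last first.
  by apply: le_lt_trans fB _; rewrite ltry.
move=> foo; exists (fine (lp_pnorm p beta f)); apply/lp_pnorm_le.
by rewrite fineK// ge0_fin_numE// lp_pnorm_ge0.
Qed.

Lemma lp_norm_lt (f : nat -> complex R) (e : R) : 0 < e ->
  (forall N, psum N f <= (e / 2) `^ p) -> (lp_norm p beta f < e%:E)%E.
Proof.
move=> e0 /lp_pnorm_le; rewrite /lp_norm; set P := lp_pnorm p beta f => Pe.
have P0 : (0 <= P)%E by exact: lp_pnorm_ge0.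
have Pfin : P \is a fin_num by rewrite ge0_fin_numE// (le_lt_trans Pe) ?ltry.
move: Pe P0; rewrite -(fineK Pfin) poweR_EFin !lee_fin lte_fin => Pe P0.
apply: (@le_lt_trans _ _ (e / 2)); last lra.
rewrite -(@powRKV _ (e / 2) p)//; last lra.
by apply: le_powR => //; rewrite invr_ge0 ltW.
Qed.

Lemma normc_le_lp_norm (f : nat -> complex R) (e : R) n :
  (lp_norm p beta f < e%:E)%E -> normc (f n) * beta n <= e.
Proof.
move=> fe; have fy : (lp_pnorm p beta f < +oo)%E.
  apply: (@lty_poweRy _ _ p^-1); first by rewrite gt_eqF// invr_gt0.
  by rewrite (lt_trans fe) ?ltry.
have Pfin : lp_pnorm p beta f \is a fin_num by rewrite ge0_fin_numE ?lp_pnorm_ge0.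
have := lexx (lp_pnorm p beta f); rewrite -{2}(fineK Pfin) => /lp_pnorm_le/(_ n.+1).
move: fe; rewrite /lp_norm -(fineK Pfin) poweR_EFin lte_fin => /ltW fe fn.
apply: le_trans fe.
rewrite -[leLHS](@powRKV _ _ p)//; last by rewrite mulr_ge0 ?normc_ge0.
apply: le_powR; [by rewrite invr_ge0 ltW|exact: powR_ge0|].
apply: le_trans fn; rewrite /psum /wsum big_ord_recr/= lerDr.
by apply: sumr_ge0 => k _; exact: powR_ge0.
Qed.

(** Closedness in terms of p-th powers of partial norms; half of [e] absorbs the
    passage from bounded partial sums to a strict inequality of norms. *)
Lemma lp_closed_approx I (f : nat -> complex R) : lp_closed p beta I ->
  lp_space p beta f ->
  (forall e, 0 < e -> exists2 g, I g & forall N, psum N (f \- g) <= e) -> I f.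
Proof.
move=> cI fl hf; apply: cI => // e e0.
have [|g Ig fg] := hf ((e / 2) `^ p); first by rewrite powR_gt0; lra.
by exists g => //; exact: lp_norm_lt.
Qed.

Lemma lp_space_fin T (f : nat -> complex R) : (forall n, (T <= n)%N -> f n = 0) ->
  lp_space p beta f.
Proof.
move=> fT; apply/lp_spaceP; exists (psum T f) => N.
have -> : psum N f = wsum p beta N (trunc T (fun n => normc (f n))).
  congr wsum; apply/funext => n; rewrite /trunc; case: ltnP => // /fT ->.
  exact: ComplexField.Normc.normc0.
exact: wsum_trunc.
Qed.

Lemma lp_space0 : lp_space p beta (cst (0 : complex R)).
Proof. exact: (@lp_space_fin 0%N). Qed.

Lemma lp_spaceD (f g : nat -> complex R) :
  lp_space p beta f -> lp_space p beta g -> lp_space p beta (f \+ g).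
Proof.
move=> /lp_spaceP[A fA] /lp_spaceP[B gB]; apply/lp_spaceP.
exists (2 `^ p * (A + B)) => N.
apply: (@le_trans _ _ (2 `^ p * (psum N f + psum N g))); last first.
  by rewrite ler_wpM2l ?powR_ge0// lerD.
apply: le_trans (wsumD _ _ _ _ _) => //; try by move=> n; exact: normc_ge0.
by apply: le_wsum => // n; [exact: normc_ge0|exact: le_normcD].
Qed.

Lemma lp_spaceZ (c : complex R) (f : nat -> complex R) :
  lp_space p beta f -> lp_space p beta (c \*o f).
Proof.
move=> /lp_spaceP[A fA]; apply/lp_spaceP.
exists (normc c `^ p * A) => N.
apply: (@le_trans _ _ (normc c `^ p * psum N f)); last first.
  by rewrite ler_wpM2l ?powR_ge0.
rewrite -wsumZ ?normc_ge0// => [|n]; last exact: normc_ge0.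
apply: le_wsum => // n; first exact: normc_ge0.
by rewrite -ComplexField.Normc.normcM.
Qed.

End LpSpace.

(** * Closed ideals *)

Section Ideals.
Variables (R : realType) (p : R) (beta delta : nat -> R).
Hypotheses (beta_gt0 : forall n, 0 < beta n) (delta_gt0 : forall n, 0 < delta n).
Hypothesis p_ge1 : 1 <= p.
Let p_gt0 : 0 < p. Proof. exact: lt_le_trans p_ge1. Qed.

Local Notation psum := (psum p beta).
Local Notation W := (shiftw beta delta).
Local Notation toC := (real_complex R).

Let delta_neq0 n : toC (delta n) != 0.
Proof. by rewrite fmorph_eq0 gt_eqF. Qed.

(** The series F with f = z^i F, in the coordinates in which the product is the
    ordinary Cauchy product. *)
Definition ncoef i (f : nat -> complex R) n : complex R :=
  f (n + i)%N / toC (delta (n + i)%N).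

Definition of_ncoef (a : nat -> complex R) n : complex R := toC (delta n) * a n.

Lemma of_ncoefK a : ncoef 0 (of_ncoef a) = a.
Proof. by apply/funext => n; rewrite /ncoef /of_ncoef addn0 mulrC mulKf. Qed.

Lemma wcauchy_low i g f n : (forall m, (m < i)%N -> f m = 0) -> (n < i)%N ->
  wcauchy delta g f n = 0.
Proof.
move=> fi ni; apply: big1 => k _.
by rewrite fi ?mulr0// (leq_ltn_trans (leq_subr _ _)).
Qed.

(** The terms with k > n involve coefficients of [f] of index less than [i]. *)
Lemma wcauchy_shift i g f n : (forall m, (m < i)%N -> f m = 0) ->
  wcauchy delta g f (n + i) =
  toC (delta (n + i)%N) * conv (ncoef 0 g) (ncoef i f) n.
Proof.
move=> fi; pose t k : complex R := toC (delta (n + i)%N /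
    (delta k * delta (n + i - k)%N)) * g k * f (n + i - k)%N.
have le_n : (n.+1 <= (n + i).+1)%N by rewrite ltnS leq_addr.
rewrite /wcauchy big_mkord (bigID (fun k : 'I_(n + i).+1 => (k < n.+1)%N))/=.
rewrite [X in _ + X]big1 => [|k]; last first.
  by rewrite -leqNgt => nk; rewrite fi ?mulr0//; have := ltn_ord k; lia.
rewrite addr0 -(big_ord_widen _ t le_n) /conv mulr_sumr; apply: eq_bigr => k _.
rewrite /t /ncoef addn0 -(addnBAC _ (leq_ord k)) fmorph_div rmorphM.
by field; rewrite !delta_neq0.
Qed.

Lemma psum_le_shift i (d : nat -> complex R) (a : nat -> R) N :
  (forall n, (n < i)%N -> d n = 0) ->
  (forall n, normc (d (n + i)%N) <= delta (n + i)%N * a n) ->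
  psum N d <= wsum p (W i) N a.
Proof.
move=> di da; apply: (@le_trans _ _ (psum (i + N) d)).
  exact/wsum_mono/leq_addl.
rewrite /psum /wsum big_split_ord/= big1 => [|n _]; last first.
  by rewrite di// ComplexField.Normc.normc0 mul0r powR0 ?gt_eqF.
rewrite add0r; apply: ler_sum => n _; rewrite [(i + n)%N]addnC.
apply: le_powR; [exact: ltW|by rewrite mulr_ge0 ?normc_ge0 ?ltW|].
by rewrite /shiftw mulrA ler_wpM2r ?(ltW (beta_gt0 _))// mulrC.
Qed.

Lemma wsum_ncoef_le i f N :
  wsum p (W i) N (fun n => normc (ncoef i f n)) <= psum (i + N) f.
Proof.
rewrite /psum /wsum big_split_ord/= -[leLHS]add0r lerD//.
  by apply: sumr_ge0 => *; exact: powR_ge0.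
apply: ler_sum => n _; rewrite [(i + n)%N]addnC /ncoef /shiftw.
rewrite ComplexField.Normc.normcM ComplexField.Normc.normcV normcR gtr0_norm//.
by rewrite mulrA divfK ?gt_eqF.
Qed.

Lemma ncoef_bounded i f : lp_space p beta f ->
  exists B, forall N, wsum p (W i) N (fun n => normc (ncoef i f n)) <= B.
Proof.
move=> /lp_spaceP[]// B fB; exists B => N.
exact: le_trans (wsum_ncoef_le _ _ _) (fB _).
Qed.

Lemma lp_sub_ideal i K : 0 <= K -> conv_bounded p (W 0) K ->
  lp_ideal p beta delta (lp_sub p beta i).
Proof.
move=> K0 hK; case: i => [i|]; split => //=.
- by move=> f [].
- by split => //; exact: lp_space0.
- move=> f g [fl fi] [gl gi]; split; first exact: lp_spaceD.
  by move=> n ni; rewrite fi// gi// addr0.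
- move=> c f [fl fi]; split; first exact: lp_spaceZ.
  by move=> n ni; rewrite fi// mulr0.
- move=> f g fl [gl gi]; split; last by move=> n; exact: wcauchy_low.
  have [A fA] := ncoef_bounded 0 fl; have [B gB] := ncoef_bounded 0 gl.
  apply/lp_spaceP => //; exists (K * (A * B)) => N.
  apply: le_trans (psum_le_shift (i := 0) _ _ _) _ => //.
    move=> n; rewrite wcauchy_shift// ComplexField.Normc.normcM normcR.
    rewrite gtr0_norm// ler_pM2l//; exact: normc_conv.
  have W0 n : 0 < W 0 n by exact: shiftw_gt0.
  apply: le_trans (wsum_conv W0 _ K0 hK _ _) _; try by move=> n; exact: normc_ge0.
  by rewrite ler_wpM2l// ler_pM ?wsum_ge0.
- by move=> _ ->; exact: lp_space0.
- by move=> f g -> ->; apply/funext => n /=; rewrite addr0.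
- by move=> c f ->; apply/funext => n /=; rewrite mulr0.
- move=> f g _ ->; apply/funext => n; apply: big1 => k _.
  by rewrite mulr0.
Qed.

(** Each coefficient is a continuous function of the series. *)
Lemma lp_norm_small_coef0 (f : nat -> complex R) n :
  (forall e : R, 0 < e -> exists2 g : nat -> complex R, g n = 0 &
     (lp_norm p beta (f \- g)%R < e%:E)%E) -> f n = 0.
Proof.
move=> hf; apply: ComplexField.Normc.eq0_normc; apply/le_anti.
rewrite normc_ge0 andbT; apply/ler_addgt0Pr => e e0; rewrite add0r.
have [|h hn he] := hf (e * beta n); first exact: mulr_gt0.
have := normc_le_lp_norm beta_gt0 p_ge1 n he.
by rewrite /= hn subr0 ler_pM2r.
Qed.

Lemma lp_sub_closed i : lp_closed p beta (lp_sub p beta i).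
Proof.
case: i => [i|] f fl hf /=; last first.
  apply/funext => n; apply: lp_norm_small_coef0 => // e /hf[g -> fg].
  by exists (cst 0).
split => // n ni; apply: lp_norm_small_coef0 => // e /hf[g [_ gi] fg].
by exists g => //; exact: gi.
Qed.

(** The multiple of z^i whose normalised coefficients are 0 and 1. *)
Definition monomial i n : complex R := toC (delta i) * (n == i)%:R.

Lemma ncoef_monomial i n : ncoef i (monomial i) n = (n == 0%N)%:R.
Proof.
rewrite /ncoef /monomial (_ : (n + i == i)%N = (n == 0%N)); last lia.
by case: eqP => [->|_]; rewrite ?mulr0 ?mul0r// mulr1 add0n divff.
Qed.

Section ClosedIdeal.
Variables (I : set (nat -> complex R)) (i : nat) (K : R).
Hypotheses (idI : lp_ideal p beta delta I) (clI : lp_closed p beta I).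
Hypotheses (K_ge0 : 0 <= K) (convK : conv_bounded p (W i) K).
Hypothesis kernel_small : forall k, (1 <= k)%N -> forall e, 0 < e ->
  exists M, forall m, (M <= m)%N -> kernel (W i) (m + k) k <= e.

Let W_gt0 n : 0 < W i n. Proof. exact: shiftw_gt0. Qed.

Lemma ideal_trunc_mul T a f : I f -> I (wcauchy delta (of_ncoef (trunc T a)) f).
Proof.
move=> If; apply: (lp_ideal_absorb idI) => //.
apply: (lp_space_fin beta_gt0 p_ge1 (T := T)) => n Tn.
by rewrite /of_ncoef /trunc ltnNge Tn mulr0.
Qed.

(** The first coefficient of [F] is moved to the left of the convolution equation,
    which leaves multiplication by a series without constant term. *)
Lemma formal_inverse_bounded F h B : F 0%N != 0 ->
  (forall n, conv h F n = (n == 0%N)%:R) ->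
  (forall N, wsum p (W i) N (fun n => normc (F n)) <= B) ->
  exists B', forall N, wsum p (W i) N (fun n => normc (h n)) <= B'.
Proof.
move=> F0 hF FB; pose a := tail 1 (fun n => normc (F n)).
have f00 : 0 < normc (F 0%N).
  rewrite lt_neqAle normc_ge0 andbT eq_sym.
  by apply: contra_neq F0 => /ComplexField.Normc.eq0_normc.
have a0 n : 0 <= a n by apply: tail_ge0 => m; exact: normc_ge0.
apply: (wsum_bounded_of_conv_le p_ge1 W_gt0 K_ge0 convK kernel_small f00 a0
  (B := B)) => //.
- by move=> n; exact: normc_ge0.
- move=> N; apply: le_trans (FB N); apply: le_wsum => // n.
  by rewrite /a /tail; case: ifP => // _; exact: normc_ge0.
move=> n; rewrite -ComplexField.Normc.normcM.
have -> : F 0%N * h n = (n == 0%N)%:R - conv (tail 1 F) h n.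
  rewrite -hF convC /conv !big_ord_recl /= subn0 mul0r add0r.
  rewrite [X in _ = _ - X](eq_bigr (fun k : 'I_n =>
    F (bump 0 k) * h (n - bump 0 k)%N))//.
  by rewrite addrK.
apply: (le_trans (le_normcD _ _)); rewrite normcN lerD//.
  by case: eqP => _; rewrite ?ComplexField.Normc.normc1 ?ComplexField.Normc.normc0.
apply: (le_trans (normc_conv _ _ _)); apply: ler_sum => k _.
rewrite ler_wpM2r ?normc_ge0// /a /tail.
by case: ifP; rewrite ?ComplexField.Normc.normc0.
Qed.

(** With [h] the formal inverse of F, the products of [f] by the truncations of
    [h] belong to [I]; they differ from the monomial by z^i times the product of
    F with the tail of [h], which is small. *)
Lemma monomial_in_ideal f : I f -> f i != 0 -> (forall n, (n < i)%N -> f n = 0) ->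
  I (monomial i).
Proof.
move=> If fi0 fi; have fl := lp_ideal_sub idI If.
have [B FB] := ncoef_bounded i fl; set F := ncoef i f in FB.
have F0 : F 0%N != 0 by rewrite /F /ncoef add0n mulf_neq0// invr_neq0.
have [h hF] := formal_inverse F0.
have [B' hB'] := formal_inverse_bounded F0 hF FB.
apply: (lp_closed_approx (p := p) (beta := beta)) => //.
  apply: (lp_space_fin beta_gt0 p_ge1 (T := i.+1)) => n.
  by rewrite /monomial => /gtn_eqF->; rewrite mulr0.
move=> e e0.
have B0 : 0 <= B by apply: le_trans (FB 0%N); exact: wsum_ge0.
have KB : 0 < K * B + 1 by rewrite ltr_wpDl// mulr_ge0.
have [T hT] := wsum_tail_small p_ge1 hB' (divr_gt0 e0 KB).
exists (wcauchy delta (of_ncoef (trunc T h)) f); first exact: ideal_trunc_mul.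
move=> N; set a := tail T _ in hT.
apply: (@le_trans _ _ (wsum p (W i) N (conv a (fun n => normc (F n))))).
  apply: psum_le_shift => n /=.
    by move=> ni; rewrite (wcauchy_low _ fi)// /monomial ltn_eqF// mulr0 subrr.
  rewrite wcauchy_shift// of_ncoefK.
  have -> : monomial i (n + i) = toC (delta (n + i)%N) * (n == 0%N)%:R.
    rewrite -(ncoef_monomial i) /ncoef mulrC divfK//.
  rewrite -hF -mulrBr conv_tail_trunc ComplexField.Normc.normcM normcR.
  rewrite gtr0_norm// ler_pM2l//; apply: le_trans (normc_conv _ _ _) _.
  apply: ler_sum => k _; rewrite ler_wpM2r ?normc_ge0// /a /tail.
  by case: ifP; rewrite ?ComplexField.Normc.normc0.
have a0 n : 0 <= a n by apply: tail_ge0 => m; exact: normc_ge0.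
apply: le_trans (wsum_conv W_gt0 _ K_ge0 convK a0 _) _.
  by move=> n; exact: normc_ge0.
apply: (@le_trans _ _ (K * (e / (K * B + 1) * B))).
  by rewrite ler_wpM2l// ler_pM ?wsum_ge0.
have -> : K * (e / (K * B + 1) * B) = e * ((K * B) / (K * B + 1)).
  by field; rewrite gt_eqF.
by rewrite ler_piMr ?(ltW e0)// ler_pdivrMr// mul1r lerDl.
Qed.

Lemma lp_sub_of_monomial : I (monomial i) -> lp_sub p beta (Some i) `<=` I.
Proof.
move=> Ii g [gl gi]; have [B GB] := ncoef_bounded i gl; set G := ncoef i g in GB.
apply: (lp_closed_approx (p := p) (beta := beta)) => // e e0.
have [T hT] := wsum_tail_small p_ge1 GB e0.
exists (wcauchy delta (of_ncoef (trunc T G)) (monomial i)).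
  exact: ideal_trunc_mul.
have mi m : (m < i)%N -> monomial i m = 0.
  by move=> mi; rewrite /monomial ltn_eqF// mulr0.
move=> N; apply: le_trans (hT N); apply: psum_le_shift => n /=.
  by move=> ni; rewrite (wcauchy_low _ mi)// gi// subrr.
rewrite wcauchy_shift// of_ncoefK.
have -> : conv (trunc T G) (ncoef i (monomial i)) n = trunc T G n.
  rewrite /conv big_ord_recr/= subnn ncoef_monomial mulr1 big1 ?add0r// => k _.
  by rewrite ncoef_monomial subn_eq0 leqNgt ltn_ord mulr0.
have -> : g (n + i)%N = toC (delta (n + i)%N) * G n.
  by rewrite /G /ncoef mulrC divfK.
rewrite -mulrBr ComplexField.Normc.normcM normcR gtr0_norm// ler_pM2l//.
by rewrite /tail /trunc; case: ifP; rewrite ?subrr ?subr0 ?ComplexField.Normc.normc0.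
Qed.

End ClosedIdeal.
End Ideals.

Unset Implicit Arguments.
Set Strict Implicit.

(** * The classification *)

Theorem theorem2p8 (R : realType) (p : R) (beta delta : nat -> R)
    (beta_gt0 : forall n, 0 < beta n) (delta_gt0 : forall n, 0 < delta n)
    (beta0 : beta 0%N = 1) (delta0 : delta 0%N = 1)
    (p_ge1 : 1 <= p)
    (hC : 1 < p -> forall i : nat, (Cconst p beta delta i < +oo)%E)
    (hB : p = 1 -> forall i : nat,
       exists N : nat, [/\ (1 <= N)%N, (i <= N)%N &
                           (Bconst beta delta i N < +oo)%E])
    (hb : forall i k : nat, (1 <= k)%N ->
       bconst beta delta i M k @[M --> \oo] --> (0 : \bar R)) :
  forall I : set (nat -> complex R),
    (lp_ideal p beta delta I /\ lp_closed p beta I) <->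
    (exists i : option nat, I = lp_sub p beta i).
Proof.
have hK i : exists2 K, 0 <= K & conv_bounded p (shiftw beta delta i) K.
  have [p1|p1|p_eq1] := ltgtP 1 p.
  - exact/conv_bounded_shiftw_Cconst/hC.
  - by move: p_ge1; rewrite leNgt p1.
  - have [N [_ iN hN]] := hB (esym p_eq1) i; rewrite -p_eq1.
    by apply: (conv_bounded_shiftw_Bconst beta_gt0 delta_gt0 iN hN) => k; exact: hb.
have [K0 K0_ge0 convK0] := hK 0%N.
move=> I; split=> [[idI clI]|[i ->]]; last first.
  by split; [exact: lp_sub_ideal convK0|exact: lp_sub_closed].
(* the index [i] below is the least order of an element of [I] *)
have [hI|] := pselect (exists n, exists2 f, I f & f n != 0); last first.
  move=> hI; exists None; apply/seteqP; split => [f If|_ ->]; last first.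
    exact: (lp_ideal_0 idI).
  apply/funext => n; apply/eqP; apply: contrapT => /negP fn.
  by apply: hI; exists n, f.
have hI' : exists n, `[< exists2 f, I f & f n != 0 >].
  by case: hI => n hn; exists n; exact/asboolP.
case: (ex_minnP hI') => i /asboolP[f If fi0] imin.
have low g n : I g -> (n < i)%N -> g n = 0.
  move=> Ig ni; apply/eqP; apply: contrapT => /negP gn.
  by move: ni; rewrite ltnNge imin//; apply/asboolP; exists g.
exists (Some i); apply/seteqP; split => [g Ig|].
  split; first exact: (lp_ideal_sub idI).
  by move=> n; exact: low.
have [K K_ge0 convK] := hK i.
have small := kernel_shiftw_small (fun k => hb i k).
apply: (lp_sub_of_monomial beta_gt0 delta_gt0 p_ge1 idI clI).
apply: (monomial_in_ideal beta_gt0 delta_gt0 p_ge1 idI clI K_ge0 convK small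
  If fi0).
by move=> n; exact: low.
Qed.
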